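(* Let $q=p^r$ be a power of a prime $p$, let $d\ge 1$, and let $M\in\mathbb{F}_q[T]$ be a nonzero polynomial which splits into linear factors over $\mathbb{F}_{q^d}$. Then, inside a fixed algebraic closure of $\mathbb{F}_q(T)$, the cyclotomic function fields satisfy $K_{q,M}\subset K_{q^d,M}$.
   Context: For a power $Q$ of $p$ (here $Q=q$ or $Q=q^d$), the Carlitz action over $\mathbb{F}_Q$ is defined on $u\in\overline{\mathbb{F}_q(T)}$ by $C_Q(T)(u)=Tu+u^{Q}$, extended $\mathbb{F}_Q$-linearly to all $N=\sum a_iT^i\in\mathbb{F}_Q[T]$ by $C_Q(N)(u)=\sum a_i C_Q(T)^{i}(u)$, where $C_Q(T)^i$ denotes the $i$-fold composite. The $N$-torsion $C_Q[N]$ is the set of $u\in\overline{\mathbb{F}_q(T)}$ with $C_Q(N)(u)=0$. The cyclotomic function field $K_{Q,N}$ is the field obtained by adjoining $C_Q[N]$ to $\mathbb{F}_Q(T)$. *)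

(* Defs.v *)
From HB Require Import structures.
From mathcomp Require Import all_boot all_order all_algebra all_field.
Set Implicit Arguments. Unset Strict Implicit. Unset Printing Implicit Defensive.
Import GRing.Theory.
Local Open Scope ring_scope.

Section CarlitzDefs.
Variable Om : fieldType.

(* F_Q inside Om: the roots of X^Q - X (in an algebraically closed field of
   characteristic p with Q a power of p, these form the field with Q elements). *)
Definition finfld (Q : nat) : {pred Om} := [pred x : Om | x ^+ Q == x].

(* C_Q(T)(u) = T u + u^Q, where T is represented by t : Om *)
Definition carlitzT (t : Om) (Q : nat) (u : Om) : Om := t * u + u ^+ Q.

Definition carlitz (t : Om) (Q : nat) (N : {poly Om}) (u : Om) : Om :=
  \sum_(i < size N) N`_i * iter i (carlitzT t Q) u.

Definition subfield_closed (P : Om -> Prop) : Prop :=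
  [/\ P 0, P 1, (forall x y, P x -> P y -> P (x - y)),
      (forall x y, P x -> P y -> P (x * y)) & (forall x, P x -> P x^-1)].

Definition gen_field (S : Om -> Prop) (x : Om) : Prop :=
  forall P : Om -> Prop, subfield_closed P -> (forall s, S s -> P s) -> P x.

Definition cyclo_field (t : Om) (Q : nat) (N : {poly Om}) : Om -> Prop :=
  gen_field (fun x => x \in finfld Q \/ x = t \/ carlitz t Q N x = 0).

Definition rat_field (t : Om) (Q : nat) : Om -> Prop :=
  gen_field (fun x => x \in finfld Q \/ x = t).
End CarlitzDefs.

(* Main.v *)
(** Write f^(e) for f with its coefficients raised to the power p^e, and Q = q^d.
    The M-torsion of the Carlitz module over F_q corresponds to the classes f in
    Om[X]/(M) with f^(r) = (X - t) f, via u |-> sum_k C_q(T^k)(u) X_k with (X_k)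
    the basis dual to (X^k); the coefficients of f and the torsion generate the
    same field.  Over F_Q there is an invertible solution g of
    g^(rd) = (X - t) g.  Then n = g g^(r) ... g^(r(d-1)) is an invertible solution
    of the equation over F_q, with coefficients in K_{Q,M}.  Any other solution f
    has a Frobenius-invariant ratio f / n, which thus lies in F_q[X]/(M); hence
    the coefficients of f, among them u up to a constant, are in K_{Q,M}. *)
Require Import Defs.
From HB Require Import structures.
From mathcomp Require Import all_boot all_order all_algebra all_field ring.
Set Implicit Arguments.
Unset Strict Implicit.
Unset Printing Implicit Defensive.

Import GRing.Theory.
Local Open Scope ring_scope.

(* The otherwise unused [chR] lets unification find the morphism instances. *)
Definition frobX (R : comNzRingType) (p : nat) (chR : p \in [pchar R]) (e : nat)
  (x : R) : R := x ^+ (p ^ e).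

(** * Powers of Frobenius as ring endomorphisms *)

Section FrobX.
Variables (R : comNzRingType) (p : nat) (chR : p \in [pchar R]) (e : nat).

Lemma frobX_is_nmod_morphism : nmod_morphism (frobX chR e).
Proof.
have p_pr := pcharf_prime chR.
split=> [|x y]; rewrite /frobX.
  by rewrite expr0n expn_eq0 -leqn0 leqNgt prime_gt0.
by rewrite exprDn_pchar // pnatX pnatE // chR.
Qed.

Lemma frobX_is_monoid_morphism : monoid_morphism (frobX chR e).
Proof. by split=> [|x y]; rewrite /frobX ?expr1n ?exprMn. Qed.

HB.instance Definition _ :=
  GRing.isNmodMorphism.Build R R (frobX chR e) frobX_is_nmod_morphism.
HB.instance Definition _ :=
  GRing.isMonoidMorphism.Build R R (frobX chR e) frobX_is_monoid_morphism.

End FrobX.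

Lemma finfld_exp (F : fieldType) (x : F) (q d : nat) :
  x \in finfld q -> x \in finfld (q ^ d).
Proof.
move=> /eqP xq; apply/eqP; elim: d => [|d IHd]; first by rewrite expn0.
by rewrite expnS exprM xq.
Qed.

Lemma modp_le_size (F : fieldType) (p q : {poly F}) :
  p != 0 -> (size q <= size p)%N ->
  q %% p = q - (q`_(size p).-1 / lead_coef p) *: p.
Proof.
move=> p0 le_qp; have sp : (0 < size p)%N by rewrite size_poly_gt0.
have lp0 : lead_coef p != 0 by rewrite lead_coef_eq0.
set r := q - _; rewrite -[q in LHS](subrK ((q`_(size p).-1 / lead_coef p) *: p)) -/r.
rewrite modpD modpZl modpp scaler0 addr0 modp_small // -(prednK sp) ltnS.
apply/leq_sizeP => j; rewrite leq_eqVlt => /predU1P[<-|lt_j].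
  by rewrite coefB coefZ -lead_coefE divfK ?subrr.
rewrite prednK // in lt_j.
by rewrite coefB coefZ (nth_default _ lt_j) (nth_default _ (leq_trans le_qp lt_j))
  mulr0 subrr.
Qed.

(** * Polynomials with coefficients in a subfield *)

Section CoefsIn.
Variables (F : fieldType) (P : F -> Prop).
Hypothesis P_field : Defs.subfield_closed P.
Let P0 : P 0. Proof. by case: P_field. Qed.
Let P1 : P 1. Proof. by case: P_field. Qed.
Let PB x y : P x -> P y -> P (x - y). Proof. by case: P_field => ? ? + ? ?; apply. Qed.
Let PM x y : P x -> P y -> P (x * y). Proof. by case: P_field => ? ? ? + ?; apply. Qed.
Let PV x : P x -> P x^-1. Proof. by case: P_field => ? ? ? ? +; apply. Qed.

Lemma closedD x y : P x -> P y -> P (x + y).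
Proof. by move=> Px Py; rewrite -[y]opprK -(sub0r y); apply: (PB Px); apply: PB. Qed.

Lemma closedX x n : P x -> P (x ^+ n).
Proof. by move=> Px; elim: n => [|n IHn]; rewrite ?expr0 // exprS; apply: PM. Qed.

Lemma coefs_closedM (f g : {poly F}) :
  (forall i, P f`_i) -> (forall i, P g`_i) -> forall i, P (f * g)`_i.
Proof.
by move=> Pf Pg i; rewrite coefM; elim/big_ind: _ => // *; [apply: closedD|apply: PM].
Qed.

(** Horner induction on f: after reducing the previous stage, multiplying by X and adding c gives
    degree at most that of g, so [modp_le_size] finishes with one subtraction whose factor lies in
    P. *)
Lemma coefs_closed_modp (f g : {poly F}) :
  (forall i, P f`_i) -> (forall i, P g`_i) -> forall i, P (f %% g)`_i.
Proof.
move=> Pf Pg; have [-> i|g0] := eqVneq g 0; first by rewrite modp0.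
elim/poly_ind: f Pf => [|f c IHf] Pf i; first by rewrite mod0p coef0.
have{}IHf : forall j, P (f %% g)`_j.
  by apply: IHf => j; have := Pf j.+1; rewrite coefD coefMX coefC addr0.
have Pc : P c by have := Pf 0; rewrite coefD coefMX coefC add0r.
have -> : (f * 'X + c%:P) %% g = (f %% g * 'X + c%:P) %% g.
  by rewrite !modpD !(mulrC _ 'X) modp_mul.
set h := f %% g * 'X + c%:P.
have Ph j : P h`_j.
  by rewrite coefD coefMX coefC; case: j => [|j]; rewrite ?add0r ?addr0 //=.
rewrite modp_le_size // => [|].
  by rewrite coefB coefZ; apply/PB/PM => //; apply: PM => //; apply: PV (Pg _).
rewrite (leq_trans (size_polyD _ _)) // geq_max.
rewrite (leq_trans (size_polyMleq _ _)) ?size_polyX ?addn2 ?ltn_modp //=.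
by rewrite (leq_trans (size_polyC_leq1 _)) // size_poly_gt0.
Qed.

End CoefsIn.

(** * Torsion points and solutions of f^(e) = (X - t) f modulo M *)

Section CarlitzSolutions.
Variables (F : fieldType) (p : nat) (chF : p \in [pchar F]) (t : F).
Implicit Types (e : nat) (M f g : {poly F}).

Local Notation "f ^[ e ]" := (map_poly (frobX chF e) f)
  (at level 2, format "f ^[ e ]").

Lemma polyOver_finfldP e M :
  reflect (M^[e] = M) (M \is a polyOver (finfld (p ^ e))).
Proof.
apply: (iffP allP) => [MF|MF x /(nthP 0)[i _ <-]]; last first.
  by apply/eqP; rewrite -[in RHS]MF coef_map.
apply/polyP=> i; rewrite coef_map /=; have [lt_iM|le_Mi] := ltnP i (size M).
  by apply/eqP/MF; rewrite mem_nth.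
by rewrite nth_default // rmorph0.
Qed.

Lemma frobX_coef e M i : M^[e] = M -> frobX chF e M`_i = M`_i.
Proof. by move=> Me; rewrite -[in RHS]Me coef_map. Qed.

Lemma map_frobXD a b f : f^[a]^[b] = f^[a + b].
Proof.
by apply/polyP=> i; rewrite !coef_map /= /frobX -exprM expnD.
Qed.

Lemma map_frobX_fixedX e M d : M^[e] = M -> M^[e * d] = M.
Proof.
move=> Me; elim: d => [|d IHd]; last by rewrite mulnS -map_frobXD Me.
by apply/polyP=> i; rewrite coef_map /= /frobX muln0 expn0.
Qed.

Definition carlitz_solution e M f := M %| f^[e] - ('X - t%:P) * f.

(* For k < deg M, the polynomials sum_i M_(i+k+1) X^i form the basis dual to (X^k)_k for the
   residue pairing modulo M. *)
Lemma torsion_generating_poly e M u :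
  M^[e] = M -> M != 0 -> carlitz t (p ^ e) M u = 0 ->
  exists2 f : {poly F}, (size f < size M)%N & 'X * f - t *: f - f^[e] = u *: M.
Proof.
move=> MF M0; have := M0; rewrite -size_poly_gt0 /carlitz.
case sM: (size M) => [//|n] _ tors.
pose w k := iter k (carlitzT t (p ^ e)) u.
pose c i := \sum_(k < n) w k * M`_(i + k.+1).
have cE i : c i = \sum_(0 <= k < n) w k * M`_(i + k.+1) by rewrite big_mkord.
have c_gt i : (n <= i)%N -> c i = 0.
  move=> le_ni; rewrite /c big1 // => k _.
  by rewrite [M`__]nth_default ?mulr0 // sM addnS ltnS (leq_trans le_ni) ?leq_addr.
exists (\poly_(i < n) c i); first by rewrite ltnS size_poly.
have fE i : (\poly_(i < n) c i)`_i = c i.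
  by rewrite coef_poly; case: ltnP => // /c_gt.
have step i : t * c i + frobX chF e (c i) = \sum_(0 <= k < n) w k.+1 * M`_(i + k.+1).
  rewrite /c rmorph_sum mulr_sumr -big_split big_mkord; apply: eq_bigr => k _ /=.
  rewrite rmorphM /= /frobX -[M`__ ^+ _]/(frobX chF e _) frobX_coef //.
  by rewrite mulrA -mulrDl.
apply/polyP=> i; rewrite !coefB coefZ coef_map /= [in RHS]coefZ mulrC coefMX !fE.
rewrite -addrA -opprD step.
have wM : \sum_(0 <= k < n.+1) w k * M`_k = 0.
  by rewrite big_mkord -[RHS]tors; apply: eq_bigr => k _; rewrite mulrC.
(* The constant coefficient is the torsion relation [wM]. In degree i + 1, one sum of n + 1 terms is
   peeled at either end: its last term vanishes since M has degree n, its first is u times the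
   coefficient of M. *)
case: i => [|i] /=; rewrite ?cE.
  move: wM; rewrite big_nat_recl // => /eqP; rewrite addr_eq0 => /eqP ->.
  by rewrite sub0r.
have := erefl (\sum_(0 <= k < n.+1) w k * M`_(i.+1 + k)).
rewrite {1}big_nat_recr // big_nat_recl //= addn0 [M`_(i.+1 + n)]nth_default; last first.
  by rewrite sM addSn ltnS leq_addl.
rewrite mulr0 addr0; under eq_bigr do rewrite addSnnS.
by move=> ->; rewrite addrK.
Qed.

(* Inverse of the previous correspondence: v_k, the leading (deg M - 1)
   coefficient of X^k g mod M divided by that of M, satisfies
   v_(k+1) = C(T)(v_k) and sum_k M_k v_k = 0, and the v_k determine g. *)
Lemma solution_coefs_closed e M g (P : F -> Prop) :
  Defs.subfield_closed P -> P t ->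
  M^[e] = M -> (1 < size M)%N -> (forall i, P M`_i) ->
  (forall v, carlitz t (p ^ e) M v = 0 -> P v) ->
  (size g < size M)%N -> carlitz_solution e M g -> forall i, P g`_i.
Proof.
move=> Pfield Pt Me sM PM Ptors sg /dvdpP[k gsol].
have M0 : M != 0 by rewrite -size_poly_gt0 ltnW.
have lM0 : lead_coef M != 0 by rewrite lead_coef_eq0.
have leadF : frobX chF e (lead_coef M) = lead_coef M.
  exact: frobX_coef.
pose n := (size M).-2; have sME : size M = n.+2 by rewrite /n; case: (size M) sM => [|[]].
pose G j := ('X^j * g) %% M; pose v j := (G j)`_n / lead_coef M.
have sG j : (size (G j) <= n.+1)%N by rewrite -ltnS -sME ltn_modp.
have GS j : G j.+1 = 'X * G j - v j *: M.
  rewrite /G exprS -mulrA -modp_mul -/(G j) modp_le_size //; last first.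
    by rewrite sME (leq_trans (size_polyMleq _ _)) // size_polyX addSn add1n ltnS.
  by rewrite sME /= mulrC coefMX.
(* Multiplied by X^j, the congruence for g turns multiplication by X into the Carlitz operator on
   coefficients, so v is a Carlitz orbit. *)
have GSt j : G j.+1 = t *: G j + (G j)^[e].
  rewrite /G map_modp /= Me rmorphM /= map_polyXn -modpZl -modpD.
  have -> : t *: ('X^j * g) + 'X^j * g^[e] = 'X^(j.+1) * g + ('X^j * k) * M.
    by rewrite -[X in _ = _ + X]mulrA -gsol exprS -mul_polyC; ring.
  by rewrite modpD modp_mull addr0.
have vS j : v j.+1 = carlitzT t (p ^ e) (v j).
  rewrite /v GSt coefD coefZ coef_map /carlitzT mulrDl mulrA; congr (_ + _).
  by rewrite expr_div_n -[in RHS]/(frobX chF e (lead_coef M)) leadF.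
have vE j : v j = iter j (carlitzT t (p ^ e)) (v 0%N).
  by elim: j => //= j <-; rewrite vS.
have Pv j : P (v j).
  elim: j => [|j IHj].
    apply: Ptors; rewrite /carlitz.
    have -> : \sum_(i < size M) M`_i * iter i (carlitzT t (p ^ e)) (v 0) =
              (\sum_(i < size M) M`_i *: G i)`_n / lead_coef M.
      rewrite coef_sum mulr_suml; apply: eq_bigr => i _.
      by rewrite -vE /v coefZ mulrA.
    have -> : \sum_(i < size M) M`_i *: G i = (M * g) %% M.
      rewrite -[M in (M * g)]coefK poly_def mulr_suml.
      rewrite (big_morph (fun x => x %% M) (id1 := 0) (op1 := +%R)) ?mod0p //; last first.
        by move=> x y; rewrite modpD.
      by apply: eq_bigr => i _; rewrite -scalerAl modpZl.
    by rewrite modp_mulr coef0 mul0r.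
  case: (Pfield) => _ _ _ PMul _; rewrite vS.
  by apply: closedD => //; [apply: PMul | apply: closedX].
(* Descent from the top coefficient, for all j at once: by [GS], a coefficient of G (j + 1) and v j
   determine the next lower coefficient of G j. For m >= n the truncated index stays at 0. *)
have PG m j : P (G j)`_(n - m).
  elim: m j => [|m IHm] j.
    rewrite subn0 -[_`_n](divfK lM0) -/(v j).
    by case: Pfield => _ _ _ + _; apply; [apply: Pv | apply: PM].
  have [lt_mn|le_nm] := ltnP m n; last first.
    by have := IHm j; move: le_nm => /[dup] /leqW; rewrite -!subn_eq0 => /eqP-> /eqP->.
  have := IHm j.+1; rewrite GS -subnSK // coefB mulrC coefMX coefZ /= => Pd.
  rewrite -[_`_(_ - _)](subrK (v j * M`_(n - m.+1).+1)); apply: closedD => //.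
  by case: Pfield => _ _ _ + _; apply.
have G0 : G 0%N = g by rewrite /G expr0 mul1r modp_small.
move=> i; have [le_in|lt_ni] := leqP i n; first by rewrite -G0 -(subKn le_in).
by rewrite nth_default; [case: Pfield | apply: leq_trans lt_ni; rewrite -ltnS -sME].
Qed.

Lemma carlitz_solution_modp e M f :
  M^[e] = M ->
  carlitz_solution e M (f %% M) = carlitz_solution e M f.
Proof.
move=> Me; rewrite /carlitz_solution /dvdp map_modp /= Me.
by rewrite !modpD !modpN modp_mul modp_id.
Qed.

(* The Frobenius shifts the product cyclically, up to the factor
   g^(rd) / g = X - t. *)
Lemma carlitz_solution_norm r d M g :
  (0 < d)%N -> carlitz_solution (r * d) M g ->
  carlitz_solution r M (\prod_(i < d) g^[r * i]).
Proof.
case: d => // d _; rewrite /carlitz_solution => gsol.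
rewrite rmorph_prod /=; under eq_bigr do rewrite map_frobXD addnC -mulnS.
rewrite big_ord_recr big_ord_recl /= muln0.
have -> : g^[0] = g by apply/polyP=> i; rewrite coef_map /= /frobX expn0 expr1.
rewrite [X in _ - X]mulrA [X in _ - X]mulrC.
under [X in _ - X * _]eq_bigr do rewrite /bump add1n.
by rewrite -mulrBr dvdp_mull.
Qed.

(** Frobenius fixes M, so it sends units modulo M to units modulo M. *)
Lemma coprimep_norm r d M g :
  M^[r] = M -> coprimep g M ->
  coprimep (\prod_(i < d) g^[r * i]) M.
Proof.
move=> MF gM; elim/big_ind: _ => [|x y Hx Hy|i _]; first exact: coprime1p.
  by rewrite coprimepMl Hx.
by rewrite -[M](map_frobX_fixedX i MF) coprimep_map.
Qed.

(** Take h to be fu times the inverse of f, reduced modulo M. Subtracting the two congruences shows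
    that M divides (h^(r) - h)(X - t) f. Both X - t and f are units modulo M, and h^(r) - h has
    degree below that of M, so it is zero. *)
Lemma carlitz_solution_ratio r M f fu :
  M^[r] = M -> M != 0 -> M.[t] != 0 ->
  coprimep f M -> carlitz_solution r M f -> carlitz_solution r M fu ->
  exists2 h : {poly F}, h^[r] = h & M %| fu - h * f.
Proof.
move=> Me M0 Mt cfM fsol fusol.
have /Bezout_eq1_coprimepP[[a b] /= ab] := cfM.
pose h := (fu * a) %% M.
have hf : M %| fu - h * f.
  rewrite /dvdp modpD modpN mulrC modp_mul mulrCA -[fu in X in X - _]mulr1 -ab mulrDr.
  by rewrite [a * f]mulrC modpD mulrA modp_mull addr0 subrr.
exists h => //.
have cXM : coprimep M (('X - t%:P) * f).
  by rewrite coprimepMr coprimep_XsubC Mt coprimep_sym.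
have : M %| (h^[r] - h) * (('X - t%:P) * f).
  have hfr : M %| fu^[r] - h^[r] * f^[r].
    by rewrite -rmorphM -rmorphB -[M]Me dvdp_map.
  have -> : (h^[r] - h) * (('X - t%:P) * f) =
    (fu^[r] - ('X - t%:P) * fu) + ('X - t%:P) * (fu - h * f)
    - (fu^[r] - h^[r] * f^[r]) - h^[r] * (f^[r] - ('X - t%:P) * f).
    by ring.
  by apply: dvdp_sub; [apply: dvdp_sub; [apply: dvdp_add|]|];
    rewrite ?dvdp_mull.
rewrite Gauss_dvdpl // => /modp_eq0P; rewrite modp_small => [/eqP|].
  by rewrite subr_eq0 => /eqP.
rewrite (leq_ltn_trans (size_polyD _ _)) // gtn_max size_polyN size_map_poly.
by rewrite !ltn_modp M0.
Qed.

End CarlitzSolutions.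

(** * Existence of an invertible solution for split M *)

Lemma closed_root_Xn_add (F : closedFieldType) (n : nat) (f : {poly F}) :
  (0 < n)%N -> (size f <= n)%N -> exists x, x ^+ n + f.[x] = 0.
Proof.
move=> n0 sf; have /closed_rootP[x] : size ('X^n + f) != 1%N.
  by rewrite size_polyDl size_polyXn ?ltnS // eqSS -lt0n.
by rewrite rootE hornerD hornerXn => /eqP; exists x.
Qed.

(* A solution modulo N lifts to N * (X - a) by adding x N, where x is a root of
   an Artin-Schreier type equation; if N(a) <> 0 one may prescribe the value at a
   to be a nonzero y with y^(Q-1) = a - t. *)
Lemma carlitz_unit_solution (F : closedFieldType) (p : nat) (chF : p \in [pchar F])
    (t : F) (e : nat) (s : seq F) :
  (0 < e)%N -> t \notin finfld (p ^ e) -> all (mem (finfld (p ^ e))) s ->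
  exists2 g : {poly F}, coprimep g (\prod_(a <- s) ('X - a%:P)) &
    carlitz_solution chF t e (\prod_(a <- s) ('X - a%:P)) g.
Proof.
move=> e0 tQ; set Q := (p ^ e)%N in tQ *.
have Q1 : (1 < Q)%N by rewrite -(expn0 p) ltn_exp2l // prime_gt1 ?(pcharf_prime chF).
have Q10 : (0 < Q.-1)%N by rewrite -ltnS prednK // ltnW.
elim: s => [_|a s IHs /= /andP[aQ /[dup] sQ /IHs[g cgN gsol]]].
  by exists 1; rewrite big_nil ?coprime1p // /carlitz_solution dvd1p.
rewrite big_cons; set N := \prod_(b <- s) _ in cgN gsol *.
have aE : frobX chF e a = a by apply/eqP.
have Ne : map_poly (frobX chF e) N = N.
  rewrite rmorph_prod; apply: eq_big_seq => b /(allP sQ) /eqP bE.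
  by rewrite rmorphB /= map_polyX map_polyC /= /frobX bE.
have at0 : a - t != 0 by rewrite subr_eq0; apply: contraNneq tQ => <-.
have /dvdpP[k gE] := gsol.
(* For g + x N the quotient k becomes k + x^Q - (X - t) x. The first condition makes it vanish at a,
   the second keeps the lift a unit at a. *)
have [x xE xg] : exists2 x, k.[a] + x ^+ Q - (a - t) * x = 0 & (g + x *: N).[a] != 0.
  (* If a is a repeated root, g(a) is already nonzero by coprimality and adding x N does not change
     it, so any root x will do. *)
  have [Na|Na] := eqVneq N.[a] 0.
    have [||x xE] := @closed_root_Xn_add F Q (k.[a]%:P - (a - t) *: 'X).
    - exact: ltnW.
    - rewrite (leq_trans (size_polyD _ _)) // geq_max size_polyN.
      rewrite (leq_trans (size_polyC_leq1 _)) ?(ltnW Q1) //.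
      by rewrite (leq_trans (size_scale_leq _ _)) // size_polyX.
    exists x; first by rewrite -[RHS]xE !(hornerD, hornerN, hornerC, hornerZ, hornerX);
      move: (x ^+ Q) => z; ring.
    rewrite hornerD hornerZ Na mulr0 addr0.
    by move: cgN; rewrite coprimep_sym => /coprimep_root; apply; apply/eqP.
  have [||y yE] := @closed_root_Xn_add F Q.-1 (- (a - t)%:P).
  - by [].
  - by rewrite size_polyN (leq_trans (size_polyC_leq1 _)).
  have{}yE : y ^+ Q.-1 = a - t.
    by apply/eqP; rewrite -subr_eq0 -[X in _ == X]yE hornerN hornerC.
  exists ((y - g.[a]) / N.[a]).
    (* Substituting this in y^Q = (a - t) y and using [gaE] yields N(a) times the required
       equation. *)
    set x := _ / _; have yx : y = g.[a] + x * N.[a] by rewrite divfK // addrC subrK.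
    apply: (mulIf Na); rewrite mul0r.
    have yQ : y ^+ Q = (a - t) * y.
      by rewrite -(prednK (ltnW Q1)) exprSr yE.
    have NaE : frobX chF e N.[a] = N.[a] by rewrite -horner_map /= Ne aE.
    have gaE : frobX chF e g.[a] = (a - t) * g.[a] + k.[a] * N.[a].
      have /(congr1 (horner^~ a)) := gE.
      rewrite hornerD hornerN !hornerM hornerXsubC => <-.
      by rewrite -horner_map /= aE addrC subrK.
    have : frobX chF e y = (a - t) * y by [].
    rewrite {1}yx rmorphD rmorphM /= gaE NaE yx /frobX -/Q => yeq.
    have /eqP := yeq; rewrite -subr_eq0 => /eqP <-;
      move: (x ^+ Q) => z; ring.
  rewrite hornerD hornerZ divfK // addrC subrK.
  apply: contra_neq at0 => y0; rewrite -yE y0 expr0n.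
  by rewrite eqn0Ngt Q10.
exists (g + x *: N).
  rewrite coprimepMr coprimep_XsubC xg /=.
  by rewrite coprimep_sym addrC -mul_polyC coprimep_addl_mul coprimep_sym.
rewrite /carlitz_solution rmorphD /= map_polyZ /= Ne.
have -> : map_poly (frobX chF e) g + frobX chF e x *: N - ('X - t%:P) * (g + x *: N) =
   (k + (frobX chF e x)%:P - ('X - t%:P) * x%:P) * N.
  rewrite -!mul_polyC [in RHS]mulrBl [in RHS]mulrDl -gE; ring.
rewrite dvdp_mul // dvdp_XsubCl rootE !hornerE /frobX -/Q.
by rewrite -[X in _ == X]xE.
Qed.

Theorem theorem1p1 (p r d : nat) (Om : closedFieldType) (t : Om) (M : {poly Om}) :
  prime p -> (0 < r)%N -> (0 < d)%N ->
  p \in [pchar Om] ->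
  (* t plays the role of T: transcendental over F_q *)
  (forall P : {poly Om}, P \is a polyOver (finfld (p ^ r)) -> P != 0 -> P.[t] != 0) ->
  (* Om is algebraic over F_q(t), hence an algebraic closure of F_q(T) *)
  (forall x : Om, exists P : {poly Om},
      [/\ P != 0, (forall i, rat_field t (p ^ r) P`_i) & root P x]) ->
  M \is a polyOver (finfld (p ^ r)) -> M != 0 ->
  (exists (c : Om) (s : seq Om), all (mem (finfld ((p ^ r) ^ d))) s /\
       M = c *: \prod_(a <- s) ('X - a%:P)) ->
  forall x : Om, cyclo_field t (p ^ r) M x -> cyclo_field t ((p ^ r) ^ d) M x.
Proof.
move=> p_pr r0 d0 chOm t_trans _ MFq M0 [c [s [sQ ME]]] x xK P Pfield PK.
case: (Pfield) => P0 P1 PB PM PV.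
have /(polyOver_finfldP chOm) Mr := MFq.
have PQ y : y \in finfld ((p ^ r) ^ d) -> P y by move=> yQ; apply: PK; left.
have Pt : P t by apply: PK; right; left.
apply: xK => // u [/finfld_exp/PQ // | [-> // | u_tors]].
have PMc i : P M`_i.
  by apply: PQ; apply: finfld_exp; apply/eqP; apply: (frobX_coef _ Mr).
have [f sf fE] := torsion_generating_poly Mr M0 u_tors.
(* Comparing coefficients of degree deg M in [fE] recovers u from f. *)
suff Pf : forall i, P f`_i.
  have lM0 : lead_coef M != 0 by rewrite lead_coef_eq0.
  rewrite -(mulfK lM0 u) lead_coefE -coefZ -fE.
  apply: (PM); last exact: PV.
  rewrite !coefB coefZ mulrC coefMX coef_map /=.
  apply: (PB); last exact: closedX.
  by apply: PB; [case: ifP | apply: PM].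
(* For constant M, the bound [sf] forces f = 0. *)
have [M1|M1] := leqP (size M) 1.
  suff -> : f = 0 by move=> i; rewrite coef0.
  by apply/eqP; rewrite -size_poly_leq0 -ltnS (leq_trans sf).
have rd0 : (0 < r * d)%N by rewrite muln_gt0 r0.
have Q1 : (1 < p ^ (r * d))%N by rewrite -(expn0 p) ltn_exp2l // prime_gt1.
have tQ : t \notin finfld (p ^ (r * d)).
  apply/negP => /eqP tE.
  (* This polynomial already has coefficients in F_q, so transcendence of t over F_q applies. *)
  suff : ('X^(p ^ (r * d)) - 'X).[t] != 0.
    by rewrite hornerD hornerN hornerXn hornerX tE subrr eqxx.
  apply: t_trans.
    by apply/(polyOver_finfldP chOm); rewrite rmorphB /= map_polyXn map_polyX.
  apply/eqP => /(congr1 (coefp (p ^ (r * d)))); rewrite /= coefB coefXn coefX coef0.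
  by rewrite eqxx gtn_eqF // subr0; apply/eqP/oner_neq0.
have sQ' : all (mem (finfld (p ^ (r * d)))) s by rewrite expnM.
have [g0 cg0 g0sol] := carlitz_unit_solution chOm rd0 tQ sQ'.
have c0 : c != 0 by apply: contraNneq M0 => c0; rewrite ME c0 scale0r.
have MN : M %= \prod_(a <- s) ('X - a%:P) by rewrite ME eqp_scale.
have MQ := map_frobX_fixedX d Mr.
(* Reduction gives the size bound required by [solution_coefs_closed], and g remains an invertible
   solution. *)
pose g := g0 %% M.
have cg : coprimep g M by rewrite coprimep_modl (eqp_coprimepr _ MN).
have gsol : carlitz_solution chOm t (r * d) M g.
  by rewrite carlitz_solution_modp // /carlitz_solution (eqp_dvdl _ MN).
have Pg : forall i, P g`_i.
  apply: (solution_coefs_closed Pfield Pt MQ M1 PMc _ _ gsol).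
    by rewrite expnM => v v_tors; apply: PK; right; right.
  by rewrite ltn_modp.
pose n := \prod_(i < d) map_poly (frobX chOm (r * i)) g.
have Pn : forall i, P n`_i.
  rewrite /n; elim/big_ind: _ => [i|f1 f2 Pf1 Pf2|j _ i].
  - by rewrite coef1; case: eqP.
  - exact: coefs_closedM.
  - by rewrite coef_map; apply: closedX.
have fsol : carlitz_solution chOm t r M f.
  rewrite /carlitz_solution.
  have -> : map_poly (frobX chOm r) f - ('X - t%:P) * f = - (u *: M).
    by rewrite -fE -mul_polyC; ring.
  by rewrite dvdpNr -mul_polyC dvdp_mull.
have Mt := t_trans M MFq M0.
have [h hr] := carlitz_solution_ratio Mr M0 Mt (coprimep_norm d Mr cg)
                 (carlitz_solution_norm d0 gsol) fsol.
(* As f is already reduced, it equals the remainder of h n modulo M. *)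
rewrite -/n /dvdp modpD modpN (modp_small sf) subr_eq0 => /eqP ->.
apply: coefs_closed_modp => //; apply: coefs_closedM => // i.
by apply: PQ; apply: finfld_exp; apply/eqP; apply: (frobX_coef _ hr).
Qed.
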